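(* Let $V=\{2,3,5,\dots\}$ be the set of prime numbers, let $b=\frac rs\in\mathbb{Q}$ with $r,s\in\mathbb{Z}$, $s\ne0$, and let $x\in\mathbb{Q}$. For each $v\in V$ with $|x|_v<1$ and $|b|_v\le1$ define $$F_v(x)=\sum_{n=0}^{\infty}\binom bn x^n=\sum_{n=0}^{\infty}\frac{b(b-1)\cdots(b-n+1)}{n!}x^n\in\mathbb{Q}_v .$$ Suppose that for a fixed prime $v'\in V$ with $|x|_{v'}<1$ and $|b|_{v'}\le1$ one has $F_{v'}(x)=c\in\mathbb{Q}$. Then $F_v(x)\in\mathbb{Q}$ for every prime $v\in V$ with $|x|_v<1$ and $|b|_v\le1$ for which $|\pm c-1|_v<1$ is satisfied (i.e. $|c-1|_v<1$ or $|-c-1|_v<1$).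
   Context: For a prime $v$, $\mathbb{Q}_v$ is the field of $v$-adic numbers and $|\cdot|_v$ the $v$-adic absolute value, normalized by $|v|_v=1/v$; the series defining $F_v(x)$ is summed in $\mathbb{Q}_v$. The $n=0$ coefficient of the series is $1$. *)

(* Defs.v *)
From HB Require Import structures.
From mathcomp Require Import all_boot all_order all_algebra ring_quotient.
From mathcomp Require Import all_classical all_reals.
From mathcomp Require Import topology sequences.

Set Implicit Arguments.
Unset Strict Implicit.
Unset Printing Implicit Defensive.
Import Order.TTheory GRing.Theory Num.Theory.
Local Open Scope classical_set_scope.
Local Open Scope ring_scope.

(* For p not prime, logn p is 0 and padic_abs p is the trivial absolute value. *)
(* This makes every construction below total in p : nat. *)
Definition padic_abs (p : nat) (x : rat) : rat :=
  if x == 0 then 0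
  else (p ^ logn p `|denq x|)%:R / (p ^ logn p `|numq x|)%:R.

Section PadicAbs.
Variable p : nat.
Implicit Types (x y : rat) (m n : int).
Local Notation abs := (padic_abs p).

Let P n : rat := (p ^ logn p `|n|)%:R.

Let P_gt0 n : 0 < P n.
Proof. by rewrite /P -p_part ltr0n part_gt0. Qed.

Let P_neq0 n : P n != 0.
Proof. by rewrite gt_eqF. Qed.

Let PM m n : m != 0 -> n != 0 -> P (m * n) = P m * P n.
Proof.
by move=> m0 n0; rewrite /P abszM lognM ?absz_gt0// expnD natrM.
Qed.

Let abs_div m n : m != 0 -> n != 0 -> abs (m%:~R / n%:~R) = P n / P m.
Proof.
move=> m0 n0; set x := _ / _.
have x0 : x != 0 by rewrite mulf_neq0 ?invr_eq0 ?intr_eq0.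
have nx0 : numq x != 0 by rewrite numq_eq0.
rewrite /padic_abs (negPf x0) -!/(P _).
have e : numq x * n = m * denq x.
  apply/(@intr_inj rat); rewrite !intrM numqE /x.
  by rewrite mulrAC divfK ?intr_eq0.
apply/eqP; rewrite eqr_div ?P_neq0// -!PM ?denq_neq0//.
by rewrite [_ * m]mulrC -e mulrC.
Qed.

Lemma padic_abs0 : abs 0 = 0.
Proof. by rewrite /padic_abs eqxx. Qed.

Lemma padic_abs_eq0 x : (abs x == 0) = (x == 0).
Proof.
rewrite /padic_abs; case: ifP => [_|_]; first by rewrite eqxx.
by rewrite gt_eqF//; apply: divr_gt0; exact: P_gt0.
Qed.

Lemma padic_abs_ge0 x : 0 <= abs x.
Proof. by rewrite /padic_abs; case: ifP => // _; apply: divr_ge0; exact/ltW/P_gt0. Qed.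

Lemma padic_abs_gt0 x : (0 < abs x) = (x != 0).
Proof. by rewrite lt_def padic_abs_eq0 padic_abs_ge0 andbT. Qed.

Lemma padic_abs1 : abs 1 = 1.
Proof. exact: divff (P_neq0 1). Qed.

Lemma padic_absN x : abs (- x) = abs x.
Proof. by rewrite /padic_abs oppr_eq0 numqN denqN abszN. Qed.

Lemma padic_abs_distC x y : abs (x - y) = abs (y - x).
Proof. by rewrite -padic_absN opprB. Qed.

Lemma padic_absM x y : abs (x * y) = abs x * abs y.
Proof.
have [->|x0] := eqVneq x 0; first by rewrite mul0r padic_abs0 mul0r.
have [->|y0] := eqVneq y 0; first by rewrite mulr0 padic_abs0 mulr0.
rewrite -(divq_num_den x) -(divq_num_den y) mulf_div -!intrM.
rewrite !abs_div ?mulf_neq0 ?numq_eq0 ?denq_neq0// !PM ?numq_eq0 ?denq_neq0//.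
by rewrite mulf_div.
Qed.

Lemma padic_absD_max x y : abs (x + y) <= Num.max (abs x) (abs y).
Proof.
wlog xy : x y / abs x <= abs y => [h|].
  have /orP[/h//|/h] := le_total (abs x) (abs y).
  by rewrite addrC maxC.
rewrite (max_idPr xy).
have [->|x0] := eqVneq x 0; first by rewrite add0r.
have [y0|y0] := eqVneq y 0.
  by move: xy; rewrite y0 padic_abs0 le_eqVlt padic_abs_eq0 (negPf x0)
    ltNge padic_abs_ge0.
have [->|xy0] := eqVneq (x + y) 0; first by rewrite padic_abs0 padic_abs_ge0.
pose d := denq x * denq y; pose a := numq x * denq y.
pose b := numq y * denq x.
have d0 : d != 0 by rewrite mulf_neq0 ?denq_neq0.
have dR : d%:~R != 0 :> rat by rewrite intr_eq0.
have xE : x = a%:~R / d%:~R.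
  by apply/(canRL (mulfK dR)); rewrite !intrM mulrA -numqE.
have yE : y = b%:~R / d%:~R.
  by apply/(canRL (mulfK dR)); rewrite !intrM mulrCA -numqE mulrC.
have xyE : x + y = (a + b)%:~R / d%:~R by rewrite xE yE -mulrDl -intrD.
have a0 : a != 0 by rewrite mulf_neq0 ?numq_eq0 ?denq_neq0.
have b0 : b != 0 by rewrite mulf_neq0 ?numq_eq0 ?denq_neq0.
have ab0 : a + b != 0.
  by apply: contraNneq xy0 => ab; rewrite xyE ab mul0r.
move: xy; rewrite {1}xE xyE {1 2}yE !abs_div//.
rewrite !ler_pM2l ?P_gt0// !lef_pV2 ?posrE ?P_gt0//.
rewrite /P !ler_nat.
have [pp|/negPf np] := boolP (prime p); last first.
  have l0 (n : nat) : logn p n = 0%N by rewrite lognE np.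
  by rewrite !l0.
rewrite !leq_exp2l ?prime_gt1// => ba.
set k := (X in (X <= _)%N); rewrite -pfactor_dvdn ?absz_gt0//.
suff : (Posz (p ^ k) %| a + b)%Z by rewrite dvdzE.
by apply: rpredD; rewrite dvdzE/= pfactor_dvdn ?absz_gt0.
Qed.

Lemma padic_absD x y : abs (x + y) <= abs x + abs y.
Proof.
apply: le_trans (padic_absD_max _ _) _.
by rewrite ge_max lerDl lerDr !padic_abs_ge0.
Qed.

Lemma padic_abs_near x y : abs (x - y) < abs y -> abs x = abs y.
Proof.
move=> h; apply/eqP; rewrite eq_le; apply/andP; split.
  by rewrite -[x](subrK y); apply: le_trans (padic_absD_max _ _) _;
    rewrite ge_max lexx (ltW h).
rewrite leNgt; apply/negP => xy.
have := padic_absD_max (y - x) x; rewrite subrK leNgt gt_max padic_abs_distC.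
by rewrite h xy.
Qed.

Lemma padic_absV x : abs x^-1 = (abs x)^-1.
Proof.
have [->|x0] := eqVneq x 0; first by rewrite invr0 padic_abs0.
apply/(mulfI (_ : abs x != 0)); first by rewrite padic_abs_eq0.
by rewrite -padic_absM !divff ?padic_abs_eq0// padic_abs1.
Qed.

Lemma padic_absp : prime p -> abs p%:R = p%:R^-1.
Proof.
move=> pp; have p0 : Posz p != 0 by case: (p) pp.
have := @abs_div p 1 p0 isT; rewrite divr1 => ->.
by rewrite /P /= logn1 expn0 logn_prime// eqxx expn1 mul1r.
Qed.

End PadicAbs.
Definition padic_cauchy_seq (p : nat) (u : nat -> rat) : Prop :=
  forall e : rat, 0 < e -> exists N : nat, forall m n : nat,
    (N <= m)%N -> (N <= n)%N -> padic_abs p (u m - u n) < e.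

Definition padic_cauchy (p : nat) : {pred nat -> rat} :=
  fun u => `[< padic_cauchy_seq p u >].

Section CauchyRing.
Variable p : nat.
Implicit Types u v : nat -> rat.
Local Notation abs := (padic_abs p).

Lemma padic_cauchy_bounded u : padic_cauchy_seq p u ->
  exists M : rat, 0 < M /\
    exists N : nat, forall n, (N <= n)%N -> abs (u n) < M.
Proof.
move=> /(_ 1 ltr01)[N uN]; exists (1 + abs (u N)).
split; first by rewrite ltr_pwDl// padic_abs_ge0.
exists N => n Nn; rewrite -[u n](subrK (u N)).
by apply: le_lt_trans (padic_absD _ _ _) _; rewrite ltrD2r uN.
Qed.

Lemma padic_cauchy_subring : subring_closed (padic_cauchy p).
Proof.
split=> [|u v /asboolP cu /asboolP cv|u v /asboolP cu /asboolP cv];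
    apply/asboolP => e e0.
- by exists 0%N => m n _ _; rewrite subrr padic_abs0.
- have e2 : 0 < e / 2 by rewrite divr_gt0.
  have [N uN] := cu _ e2; have [K vK] := cv _ e2.
  exists (maxn N K) => m n; rewrite !geq_max => /andP[Nm Km] /andP[Nn Kn].
  have -> : (u - v) m - (u - v) n = (u m - u n) + (v n - v m).
    by rewrite /= !fctE opprB addrACA [- v m + _]addrC addrACA.
  apply: le_lt_trans (padic_absD _ _ _) _.
  by rewrite [e]splitr ltrD ?uN ?vK.
- have [A [A0 [NA uA]]] := padic_cauchy_bounded cu.
  have [B [B0 [NB vB]]] := padic_cauchy_bounded cv.
  have eA : 0 < e / 2 / A by rewrite !divr_gt0.
  have eB : 0 < e / 2 / B by rewrite !divr_gt0.
  have [N uN] := cu _ eB; have [K vK] := cv _ eA.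
  exists (maxn (maxn NA NB) (maxn N K)) => m n; rewrite !geq_max.
  move=> /andP[/andP[Am Bm] /andP[Nm Km]] /andP[/andP[An Bn] /andP[Nn Kn]].
  have -> : (u * v) m - (u * v) n = u m * (v m - v n) + (u m - u n) * v n.
    by rewrite /= !fctE mulrBr mulrBl addrA subrK.
  apply: le_lt_trans (padic_absD _ _ _) _; rewrite !padic_absM [e]splitr.
  apply: ltrD.
    rewrite -[ltRHS](divfK (lt0r_neq0 A0)) [ltRHS]mulrC.
    by apply: ltr_pM; rewrite ?padic_abs_ge0 ?uA ?vK.
  rewrite -[ltRHS](divfK (lt0r_neq0 B0)).
  by apply: ltr_pM; rewrite ?padic_abs_ge0 ?vB ?uN.
Qed.

HB.instance Definition _ := GRing.isSubringClosed.Build _ (padic_cauchy p)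
  padic_cauchy_subring.

End CauchyRing.

Record padic_cauchy_type (p : nat) := PadicCauchy {
  padic_cauchy_val :> nat -> rat;
  _ : padic_cauchy_val \in padic_cauchy p
}.

HB.instance Definition _ p := [isSub for @padic_cauchy_val p].
HB.instance Definition _ p := [Choice of padic_cauchy_type p by <:].
HB.instance Definition _ p :=
  [SubChoice_isSubComNzRing of padic_cauchy_type p by <:].

Definition padic_null_seq (p : nat) (u : nat -> rat) : Prop :=
  forall e : rat, 0 < e -> \forall n \near \oo, padic_abs p (u n) < e.

Definition padic_null (p : nat) : {pred padic_cauchy_type p} :=
  fun u => `[< padic_null_seq p u >].

Section NullIdeal.
Variable p : nat.
Implicit Types u v : padic_cauchy_type p.
Local Notation abs := (padic_abs p).

Lemma padic_cauchyP u : padic_cauchy_seq p u.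
Proof. by case: u => u /= /asboolP. Qed.

Lemma padic_null_idealr : idealr_closed (@padic_null p).
Proof.
split.
- apply/asboolP => e e0; apply: nearW => n.
  by rewrite /= padic_abs0.
- apply/negP => /asboolP /(_ 1 ltr01) [N _ /(_ N (leqnn N))].
  by rewrite /= padic_abs1 ltxx.
- move=> a u v /asboolP nu /asboolP nv; apply/asboolP => e e0.
  have [A [A0 [N aA]]] := padic_cauchy_bounded (padic_cauchyP a).
  have e2 : 0 < e / 2 by rewrite divr_gt0.
  have eA : 0 < e / 2 / A by rewrite !divr_gt0.
  near=> n.
  have -> : (a * u + v : padic_cauchy_type p) n = a n * u n + v n by [].
  apply: le_lt_trans (padic_absD _ _ _) _; rewrite padic_absM [e]splitr.
  apply: ltrD; last by near: n; exact: nv.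
  rewrite -[ltRHS](divfK (lt0r_neq0 A0)) [ltRHS]mulrC.
  apply: ltr_pM; rewrite ?padic_abs_ge0//.
    by apply: aA; near: n; exact: nbhs_infty_ge.
  by near: n; exact: nu.
Unshelve. all: by end_near. Qed.

HB.instance Definition _ := isIdealr.Build (padic_cauchy_type p)
  (@padic_null p) padic_null_idealr.

(* A Cauchy sequence that does not tend to 0 is eventually of constant        *)
(* absolute value, by the ultrametric inequality.                             *)
Lemma padic_nonnull u : ~ padic_null_seq p u ->
  exists2 r : rat, 0 < r & \forall n \near \oo, abs (u n) = r.
Proof.
move=> /existsNP[e /not_implyP[e0 h]].
have [N uN] := padic_cauchyP u e0.
have [n0 Nn0 un0] : exists2 n, (N <= n)%N & e <= abs (u n).
  apply: contrapT => k; apply: h; exists N => //= n Nn.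
  by rewrite ltNge; apply/negP => un; apply: k; exists n.
exists (abs (u n0)); first exact: lt_le_trans un0.
exists N => //= n Nn; apply: padic_abs_near.
by apply: lt_le_trans un0; exact: uN.
Qed.

End NullIdeal.

Definition padic (p : nat) := {ideal_quot @padic_null p}.
Notation "''Q_[' p ]" := (padic p) (format "''Q_[' p ]") : type_scope.

HB.instance Definition _ p := GRing.ComNzRing.on 'Q_[p].
Section PadicField.
Variable p : nat.
Implicit Types (u v : padic_cauchy_type p) (x y z : 'Q_[p]).
Local Notation abs := (padic_abs p).
Local Notation pi := (\pi_('Q_[p]))%qT.

Lemma padic_eqP u v :
  pi u = pi v <-> padic_null_seq p (fun n => u n - v n).
Proof.
have -> : (pi u = pi v) <-> (u - v \in @padic_null p).
  by rewrite Quotient.idealrBE; split=> /eqP.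
by split=> /asboolP.
Qed.

Lemma padic_eq0P u : pi u = 0 <-> padic_null_seq p u.
Proof.
rewrite -[0](rmorph0 pi) padic_eqP.
have -> : (fun n => u n - (0 : padic_cauchy_type p) n) = u; last by [].
by apply/funext => n; rewrite /= subr0.
Qed.

Lemma padic_cauchyV u : ~ padic_null_seq p u ->
  (fun n => (u n)^-1) \in padic_cauchy p.
Proof.
move=> /padic_nonnull[r r0 [N _ uN]]; apply/asboolP => e e0.
have er : 0 < e * r ^+ 2 by rewrite mulr_gt0// exprn_gt0.
have [K uK] := padic_cauchyP u er.
exists (maxn N K) => m n; rewrite !geq_max => /andP[Nm Km] /andP[Nn Kn].
have um : abs (u m) = r by exact: uN.
have un : abs (u n) = r by exact: uN.
have um0 : u m != 0 by rewrite -(padic_abs_eq0 p) um gt_eqF.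
have un0 : u n != 0 by rewrite -(padic_abs_eq0 p) un gt_eqF.
have -> : (u m)^-1 - (u n)^-1 = (u n - u m) / (u m * u n).
  by rewrite mulrBl invfM mulrCA divff// mulr1 [_^-1 * _]mulrC mulrCA divff// mulr1.
by rewrite padic_absM padic_absV padic_absM um un -expr2 ltr_pdivrMr
  ?exprn_gt0// uK.
Qed.

Definition padic_inv x : 'Q_[p] :=
  if pselect (padic_null_seq p (repr x)) is right h
  then pi (PadicCauchy (padic_cauchyV h)) else 0.

Lemma padic_mulVf x : x != 0 -> padic_inv x * x = 1.
Proof.
rewrite /padic_inv; case: pselect => [/padic_eq0P|nx x0].
  by rewrite reprK => ->; rewrite eqxx.
rewrite -[X in _ * X = _]reprK -rmorphM -[1](rmorph1 pi).
apply/padic_eqP => e e0.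
have [r r0 ur] := padic_nonnull nx; near=> n.
have un : abs (repr x n) = r by near: n.
have un0 : repr x n != 0 by rewrite -(padic_abs_eq0 p) un gt_eqF.
suff : abs ((repr x n)^-1 * repr x n - 1) < e by [].
by rewrite mulVf// subrr padic_abs0.
Unshelve. all: by end_near. Qed.

Lemma padic_invr0 : padic_inv 0 = 0.
Proof.
rewrite /padic_inv; case: pselect => // h; exfalso; apply: h.
by apply/padic_eq0P; rewrite reprK.
Qed.

HB.instance Definition _ :=
  GRing.ComNzRing_isField.Build 'Q_[p] padic_mulVf padic_invr0.

Lemma padic_const_subproof (a : rat) : (fun=> a) \in padic_cauchy p.
Proof.
by apply/asboolP => e e0; exists 0%N => m n _ _; rewrite subrr padic_abs0.
Qed.

Definition padic_of_rat (a : rat) : 'Q_[p] :=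
  pi (PadicCauchy (padic_const_subproof a)).

Lemma padic_of_rat_zmod : zmod_morphism padic_of_rat.
Proof.
move=> a b; rewrite /padic_of_rat -rmorphB; congr pi.
exact: val_inj.
Qed.

Lemma padic_of_rat_monoid : monoid_morphism padic_of_rat.
Proof.
split=> [|a b].
  by rewrite -[RHS](rmorph1 pi); congr pi; exact: val_inj.
by rewrite /padic_of_rat -rmorphM; congr pi; exact: val_inj.
Qed.

HB.instance Definition _ :=
  GRing.isZmodMorphism.Build rat 'Q_[p] padic_of_rat padic_of_rat_zmod.
HB.instance Definition _ :=
  GRing.isMonoidMorphism.Build rat 'Q_[p] padic_of_rat padic_of_rat_monoid.

(* The extension of |.|_p to Q_p, whose values are those of |.|_p on Q.       *)
Definition padic_norm x : rat :=
  if x == 0 then 0 else get [set r | \forall n \near \oo, abs (repr x n) = r].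

Lemma padic_normE u (r : rat) : 0 < r ->
  (\forall n \near \oo, abs (u n) = r) -> padic_norm (pi u) = r.
Proof.
move=> r0 ur; rewrite /padic_norm; case: eqP => [/padic_eq0P/(_ r r0) h|nu].
  suff : exists n, abs (u n) = r /\ abs (u n) < r.
    by move=> [n [->]]; rewrite ltxx.
  by near \oo => n; exists n; split; near: n.
have xu : pi (repr (pi u)) = pi u by rewrite reprK.
move/padic_eqP/(_ r r0) : xu => xu.
have xr : \forall n \near \oo, abs (repr (pi u) n) = r.
  near=> n; have un : abs (u n) = r by near: n.
  by rewrite -un; apply: padic_abs_near; rewrite un; near: n.
case: xgetP => [s _ /= xs|/(_ r)//].
suff : exists n, abs (repr (pi u) n) = r /\ abs (repr (pi u) n) = s.
  by move=> [n [<- <-]].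
by near \oo => n; exists n; split; near: n.
Unshelve. all: by end_near. Qed.

Lemma padic_norm0 : padic_norm 0 = 0.
Proof. by rewrite /padic_norm eqxx. Qed.

Lemma padic_normP x : x != 0 -> exists u, [/\ x = pi u, 0 < padic_norm x &
  \forall n \near \oo, abs (u n) = padic_norm x].
Proof.
move=> x0; have : ~ padic_null_seq p (repr x).
  by move=> /padic_eq0P; rewrite reprK; exact/eqP.
move=> /padic_nonnull[r r0 xr].
have nr : padic_norm x = r by rewrite -[x]reprK; exact: padic_normE.
by exists (repr x); rewrite nr reprK.
Qed.

Lemma padic_norm_ge0 x : 0 <= padic_norm x.
Proof.
have [->|/padic_normP[u [_ /ltW//]]] := eqVneq x 0.
by rewrite padic_norm0.
Qed.

Lemma padic_norm_eq0 x : (padic_norm x == 0) = (x == 0).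
Proof.
have [->|/padic_normP[u [_ h _]]] := eqVneq x 0; first by rewrite padic_norm0 eqxx.
by rewrite gt_eqF.
Qed.

Lemma padic_norm_rat (a : rat) : padic_norm (padic_of_rat a) = abs a.
Proof.
have [->|a0] := eqVneq a 0; first by rewrite rmorph0 padic_norm0 padic_abs0.
by apply: padic_normE; [rewrite padic_abs_gt0|exact: nearW].
Qed.

Lemma padic_normM x y : padic_norm (x * y) = padic_norm x * padic_norm y.
Proof.
have [->|x0] := eqVneq x 0; first by rewrite mul0r padic_norm0 mul0r.
have [->|y0] := eqVneq y 0; first by rewrite mulr0 padic_norm0 mulr0.
have [u [xE xr ux]] := padic_normP x0.
have [v [yE yr vy]] := padic_normP y0.
rewrite {1}xE {1}yE -rmorphM; apply: padic_normE; first exact: mulr_gt0.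
near=> n; rewrite /= padic_absM; congr (_ * _); near: n; [exact: ux|exact: vy].
Unshelve. all: by end_near. Qed.

Lemma padic_normD_max x y :
  padic_norm (x + y) <= Num.max (padic_norm x) (padic_norm y).
Proof.
have [->|x0] := eqVneq x 0; first by rewrite add0r le_max lexx orbT.
have [->|y0] := eqVneq y 0; first by rewrite addr0 le_max lexx.
have [->|xy0] := eqVneq (x + y) 0.
  by rewrite padic_norm0 le_max padic_norm_ge0.
have [u [xE xr ux]] := padic_normP x0.
have [v [yE yr vy]] := padic_normP y0.
have [w [wE wr wxy]] := padic_normP xy0.
have /padic_eqP/(_ _ wr) d : pi w = pi (u + v) 
  by rewrite -wE xE yE -rmorphD.
near \oo => n.
have <- : abs (u n) = padic_norm x by near: n.
have <- : abs (v n) = padic_norm y by near: n.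
have wn : abs (w n) = padic_norm (x + y) by near: n.
have : abs (w n - (u + v : padic_cauchy_type p) n) < abs (w n).
  by rewrite wn; near: n.
rewrite -wn padic_abs_distC => /padic_abs_near <-.
exact: padic_absD_max.
Unshelve. all: by end_near. Qed.

Lemma padic_normN x : padic_norm (- x) = padic_norm x.
Proof.
by rewrite -mulN1r padic_normM -(rmorphN1 padic_of_rat) padic_norm_rat
  padic_absN padic_abs1 mul1r.
Qed.

Lemma padic_normD x y : padic_norm (x + y) <= padic_norm x + padic_norm y.
Proof.
apply: le_trans (padic_normD_max _ _) _.
by rewrite ge_max lerDl lerDr !padic_norm_ge0.
Qed.

Definition padic_dist x y := padic_norm (x - y).

Let distxx x : padic_dist x x = 0.
Proof. by rewrite /padic_dist subrr padic_norm0. Qed.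

Let dist_eq0 x y : padic_dist x y = 0 -> x = y.
Proof. by move/eqP; rewrite padic_norm_eq0 subr_eq0 => /eqP. Qed.

Let distC x y : padic_dist x y = padic_dist y x.
Proof. by rewrite /padic_dist -padic_normN opprB. Qed.

Let distD y x z : padic_dist x z <= padic_dist x y + padic_dist y z.
Proof. by rewrite /padic_dist -[x - z](subrKA y) padic_normD. Qed.

HB.instance Definition _ := isPointed.Build 'Q_[p] 0.
HB.instance Definition _ :=
  isMetric.Build rat 'Q_[p] distxx dist_eq0 distC distD.

Lemma padic_ballE x e y : ball x e y = (padic_norm (x - y) < e) :> Prop.
Proof. by rewrite ballEmdist. Qed.

(* A Cauchy sequence of rationals converges in Q_p to the class it defines.   *)
Lemma padic_cvg u x : x = pi u -> (fun n => padic_of_rat (u n)) @ \oo --> x.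
Proof.
move=> xu; apply/cvg_ballP => e e0.
have [N uN] := padic_cauchyP u e0.
have e2 : 0 < e / 2 by rewrite divr_gt0.
have [K uK] := padic_cauchyP u e2.
exists K => //= m Km; rewrite padic_ballE.
have [->|x0] := eqVneq (x - padic_of_rat (u m)) 0; first by rewrite padic_norm0.
have [v [vE r0 vr]] := padic_normP x0.
have : pi v = pi (u - PadicCauchy (padic_const_subproof (u m))).
  by rewrite -vE xu -rmorphB.
move=> /padic_eqP/(_ _ e2) d.
near \oo => n.
have <- : abs (v n) = padic_norm (x - padic_of_rat (u m)) by near: n.
rewrite -[v n](subrK (u n - u m)); apply: le_lt_trans (padic_absD _ _ _) _.
rewrite [e]splitr ltrD//; first by near: n; exact: d.
by apply: uK => //; near: n; exact: nbhs_infty_ge.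
Unshelve. all: by end_near. Qed.

Lemma padic_dense x e : 0 < e -> exists a, padic_norm (x - padic_of_rat a) < e.
Proof.
move=> e0; have := padic_cvg (esym (reprK x)).
move=> /cvg_ballP/(_ e e0)[N _ /(_ N (leqnn N))] /=.
by rewrite padic_ballE => h; exists (repr x N).
Qed.

Lemma padic_complete (F : set_system 'Q_[p]) :
  ProperFilter F -> cauchy F -> cvg F.
Proof.
move=> PF /cauchyP cF.
have inv_small (e : rat) : 0 < e ->
    exists N, forall n, (N <= n)%N -> n.+1%:R^-1 <= e.
  move=> e0; exists (Num.truncn e^-1) => n Nn.
  rewrite -[leRHS]invrK lef_pV2 ?posrE ?invr_gt0// ltW//.
  by apply: lt_le_trans (truncnS_gt _) _; rewrite ler_nat.
have /choice[a aF] (k : nat) : exists a, F (ball (padic_of_rat a) k.+1%:R^-1).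
  have k0 : 0 < k.+1%:R^-1 / 2 :> rat by rewrite divr_gt0 ?invr_gt0.
  have [x Fx] := cF _ k0; have [a xa] := padic_dense x k0.
  exists a; apply: filterS Fx => y xy; apply: ball_split xy.
  apply: ball_sym; rewrite padic_ballE. exact: xa.
have ca : a \in padic_cauchy p.
  apply/asboolP => e e0; have e2 : 0 < e / 2 by rewrite divr_gt0.
  have [N Ne] := inv_small _ e2; exists N => m n Nm Nn.
  have [z [mz nz]] := filter_ex (filterI (aF m) (aF n)).
  rewrite -padic_norm_rat rmorphB -padic_ballE; apply: (@ball_splitl _ _ z).
    by apply: le_ball mz; exact: Ne.
  by apply: le_ball nz; exact: Ne.
apply/cvg_ex; exists (pi (PadicCauchy ca) : 'Q_[p]); apply/fcvg_ballP => e e0.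
have e2 : 0 < e / 2 by rewrite divr_gt0.
have [N Ne] := inv_small _ e2.
have /cvg_ballP/(_ _ e2) [K _ Kx] := padic_cvg (erefl (pi (PadicCauchy ca))).
have := aF (maxn N K); apply: filterS => y ay.
apply: (ball_split (Kx (maxn N K) _)); first by rewrite /= leq_maxr.
by apply: le_ball ay; apply: Ne; rewrite leq_maxl.
Qed.

HB.instance Definition _ := Uniform_isComplete.Build 'Q_[p] padic_complete.

End PadicField.

Definition gbinom (b : rat) (n : nat) : rat :=
  (\prod_(i < n) (b - i%:R)) / n`!%:R.

Definition padic_binomial_series (v : nat) (b x : rat) : 'Q_[v] :=
  limn (series (fun n => padic_of_rat v (gbinom b n * x ^+ n))).

(* Main.v *)
(* The coefficients of the binomial series are v-integral when b is, so
   F_v^b(x) converges and, by Vandermonde's identity, is multiplicative in b.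
   Writing b = r/s in lowest terms, F_v^b(x)^s = F_v^r(x) = (1+x)^r, a rational
   number that does not depend on v; at v' it equals c^s. At v, the numbers
   F_v^b(x) and c (or -c) are both congruent to 1 and, up to sign, have the same
   s-th power, while s is a v-adic unit, so they coincide. *)
Require Import Defs.
From mathcomp Require Import all_boot all_order all_algebra.
From mathcomp Require Import all_classical topology normedtype sequences.
From mathcomp Require Import ring.
Import Order.TTheory GRing.Theory Num.Theory.
Import numFieldNormedType.Exports.
Local Open Scope classical_set_scope.
Local Open Scope ring_scope.

(** * Binomial coefficients with rational upper index *)

Lemma gbinom0r (b : rat) : gbinom b 0 = 1.
Proof. by rewrite /gbinom big_ord0 divr1. Qed.

Lemma gbinomS (b : rat) (n : nat) :
  n.+1%:R * gbinom b n.+1 = (b - n%:R) * gbinom b n.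
Proof.
rewrite /gbinom big_ord_recr/= factS natrM invfM.
have : n.+1%:R != 0 :> rat by rewrite pnatr_eq0.
by move: n.+1%:R => m m0; rewrite mulrCA mulVKf// [_ * (b - _)]mulrC -mulrA.
Qed.

Lemma gbinom_nat (m n : nat) : gbinom m%:R n = 'C(m, n)%:R.
Proof.
elim: n => [|n IHn]; first by rewrite gbinom0r bin0.
apply/(@mulfI _ n.+1%:R); first by rewrite pnatr_eq0.
rewrite gbinomS IHn -natrM mul_bin_left natrM.
have [nm|mn] := leqP n m; first by rewrite natrB.
by rewrite bin_small// !mulr0.
Qed.

(** By induction on [n]. After multiplication by [n + 1 = i + (n + 1 - i)], [gbinomS] absorbs each
    part into one of the two factors, and the coefficients [a - i] and [b - (n - i)] add up to
    [a + b - n]. *)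
Lemma gbinom_Vandermonde (a b : rat) (n : nat) :
  \sum_(i < n.+1) gbinom a i * gbinom b (n - i) = gbinom (a + b) n.
Proof.
elim: n => [|n IHn]; first by rewrite big_ord1 !gbinom0r mulr1.
apply/(@mulfI _ n.+1%:R); first by rewrite pnatr_eq0.
rewrite gbinomS -IHn !mulr_sumr.
pose f (i : nat) := gbinom a i * gbinom b (n.+1 - i).
transitivity (\sum_(i < n.+2) (i%:R * f i) +
              \sum_(i < n.+2) ((n.+1 - i)%:R * f i)).
  rewrite -big_split; apply: eq_bigr => i _ /=.
  by rewrite -mulrDl -natrD subnKC// -ltnS.
rewrite big_ord_recl/= mul0r add0r [X in _ + X]big_ord_recr/= subnn mul0r addr0.
rewrite -big_split; apply: eq_bigr => i _ /=.
have ni : (i <= n)%N by rewrite -ltnS.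
rewrite /f /bump/= add1n subSS subSn// [X in X + _]mulrA gbinomS.
rewrite [X in _ + X]mulrCA gbinomS natrB//; ring.
Qed.

(** * Integrality of the binomial coefficients *)

Section PadicIntegrality.
Variable p : nat.
Hypothesis p_prime : prime p.
Local Notation abs := (padic_abs p).

Lemma padic_abs_intE (m : int) : m != 0 -> abs m%:~R = (p ^ logn p `|m|)%:R^-1.
Proof.
by move=> m0; rewrite /padic_abs intr_eq0 (negPf m0) denq_int numq_int logn1 div1r.
Qed.

Lemma padic_abs_int_le1 (m : int) : abs m%:~R <= 1.
Proof.
have [->|m0] := eqVneq m 0; first by rewrite padic_abs0 ler01.
by rewrite padic_abs_intE// invf_le1 ?ltr0n ?ler1n expn_gt0 prime_gt0.
Qed.

Lemma padic_abs_nat_le1 (n : nat) : abs n%:R <= 1.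
Proof. exact: (padic_abs_int_le1 n). Qed.

Lemma padic_absM_le1 (x y : rat) : abs x <= 1 -> abs y <= 1 -> abs (x * y) <= 1.
Proof. by move=> x1 y1; rewrite padic_absM mulr_ile1 ?padic_abs_ge0. Qed.

Lemma padic_absD_le (x y M : rat) : abs x <= M -> abs y <= M -> abs (x + y) <= M.
Proof.
by move=> xM yM; apply: le_trans (padic_absD_max _ _ _) _; rewrite ge_max xM.
Qed.

Lemma padic_abs_sum_le (I : Type) (s : seq I) (P : pred I) (f : I -> rat) (M : rat) :
  0 <= M -> (forall i, P i -> abs (f i) <= M) ->
  abs (\sum_(i <- s | P i) f i) <= M.
Proof.
move=> M0 fM; apply: (big_ind (fun y => abs y <= M)) => //.
by move=> x y; apply: padic_absD_le.
Qed.

Lemma padic_abs_coprime (n : nat) : coprime p n -> abs n%:R = 1.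
Proof.
case: n => [|n pn]; first by rewrite /coprime gcdn0 => /eqP p1; move: p_prime; rewrite p1.
by rewrite (@padic_abs_intE n.+1)//= (logn_coprime pn) expn0 invr1.
Qed.

(** If [p] divided the reduced denominator, it would not divide the numerator, and the absolute
    value of [b] would be a power of [p] greater than 1. *)
Lemma padic_int_coprime (b : rat) : abs b <= 1 -> coprime p `|denq b|.
Proof.
move=> b1; rewrite prime_coprime//; apply/negP => pd.
have [b0|b0] := eqVneq b 0.
  by move: pd; rewrite b0 dvdn1 => /eqP p1; move: p_prime; rewrite p1.
have pn : ~~ (p %| `|numq b|)%N.
  apply/negP => pn; have : (p %| gcdn `|numq b| `|denq b|)%N by rewrite dvdn_gcd pn.
  by rewrite (eqP (coprime_num_den b)) dvdn1 => /eqP p1; move: p_prime; rewrite p1.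
move: b1; rewrite /padic_abs (negPf b0).
rewrite (logn_coprime (m := `|numq b|)) ?prime_coprime// expn0 divr1.
rewrite lern1 leqNgt -(expn0 p) ltn_exp2l ?prime_gt1//.
by rewrite logn_gt0 mem_primes p_prime absz_gt0 denq_neq0 pd.
Qed.

(** The denominator of [b] is invertible modulo [p ^ k]; its inverse [u], given by Bezout, times the
    numerator of [b], reduced modulo [p ^ k], is the required [m]. *)
Lemma padic_int_approx (b : rat) (k : nat) : abs b <= 1 ->
  exists m : nat, abs (b - m%:R) <= abs (p ^ k)%:R.
Proof.
move=> b1; have := padic_int_coprime b b1 => pd.
have [u [v uv]] := Bezoutz (denq b) (p ^ k)%N.
have g1 : gcdz (denq b) (p ^ k)%N = 1.
  by apply/eqP; rewrite -[_ == _]/(coprimez _ _) coprimezE coprime_sym coprimeXl.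
rewrite g1 in uv.
set q := (p ^ k)%N in uv *.
have q0 : q%:Z != 0 by rewrite eqz_nat -lt0n expn_gt0 prime_gt0.
have /gez0_abs mE : 0 <= ((u * numq b) %% q)%Z by exact: modz_ge0.
exists `|((u * numq b) %% q)%Z|%N.
have -> : b - `|((u * numq b) %% q)%Z|%:R
    = (b * v%:~R + ((u * numq b) %/ q)%Z%:~R) * q%:R :> rat.
  have e1 := congr1 (fun z : int => z%:~R : rat) (divz_eq (u * numq b) q).
  have e2 := congr1 (fun z : int => z%:~R : rat) uv.
  move: e1 e2; rewrite -mE !(intrM, intrD) /= numqE => e1 e2.
  have -> : (`|((u * numq b) %% q)%Z|)%:R
     = u%:~R * (b * (denq b)%:~R) - ((u * numq b) %/ q)%Z%:~R * q%:R :> rat.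
    by rewrite e1 addrAC subrr add0r.
  rewrite -[X in X - _ = _]mulr1 -[X in _ * X]/(1%:~R) -e2; ring.
rewrite padic_absM -[leRHS]mul1r ler_wpM2r ?padic_abs_ge0//.
by rewrite padic_absD_le ?padic_absM_le1 ?padic_abs_int_le1.
Qed.

(** For a natural number [m] the coefficient is an integer, so [n!] divides the falling factorial of
    [m]. Falling factorials do not increase p-adic distances between p-integral numbers, so it is
    enough that [m] approximates [b] up to the p-part of [n!]. *)
Lemma padic_abs_gbinom_le1 (b : rat) (n : nat) : abs b <= 1 -> abs (gbinom b n) <= 1.
Proof.
move=> b1; pose ff (a : rat) := \prod_(i < n) (a - i%:R).
have [m bm] := padic_int_approx b (logn p n`!) b1.
have nf0 : n`!%:R != 0 :> rat by rewrite pnatr_eq0 -lt0n fact_gt0.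
have anf : 0 < abs n`!%:R by rewrite padic_abs_gt0.
have abm : abs (b - m%:R) <= abs n`!%:R.
  apply: le_trans bm _.
  rewrite (@padic_abs_intE (p ^ logn p n`!)%N) ?(@padic_abs_intE n`!)//=.
  - by rewrite pfactorK.
  - by rewrite eqz_nat -lt0n fact_gt0.
  - by rewrite eqz_nat -lt0n expn_gt0 prime_gt0.
have fm : abs (ff m%:R) <= abs n`!%:R.
  have -> : ff m%:R = 'C(m, n)%:R * n`!%:R by rewrite -gbinom_nat divfK.
  by rewrite padic_absM ler_piMl ?padic_abs_ge0 ?padic_abs_nat_le1.
(* Factor by factor, the difference of the two products is a combination of multiples of [b - m]
   with p-integral coefficients. *)
have fbm : abs (ff b - ff m%:R) <= abs (b - m%:R).
  rewrite /ff; elim: (n) => [|k IHk].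
    by rewrite !big_ord0 subrr padic_abs0 padic_abs_ge0.
  rewrite !big_ord_recr/=.
  set B := \prod_(i < k) _ in IHk *; set M := \prod_(i < k) _ in IHk *.
  have -> : B * (b - k%:R) - M * (m%:R - k%:R)
    = (B - M) * (b - k%:R) + M * (b - m%:R) by ring.
  apply: padic_absD_le; rewrite padic_absM.
    rewrite -[leRHS]mulr1 ler_pM ?padic_abs_ge0//.
    by rewrite padic_absD_le ?padic_absN ?padic_abs_nat_le1.
  rewrite ler_piMl ?padic_abs_ge0// /M.
  apply: (big_ind (fun y => abs y <= 1)) => [|y z|i _].
  - by rewrite padic_abs1.
  - exact: padic_absM_le1.
  - by rewrite padic_absD_le ?padic_absN ?padic_abs_nat_le1.
have : abs (ff b) <= abs n`!%:R.
  by rewrite -[ff b](subrK (ff m%:R)) padic_absD_le// (le_trans fbm).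
by rewrite -[gbinom b n]/(ff b / _) padic_absM padic_absV ler_pdivrMr// mul1r.
Qed.

End PadicIntegrality.

(** * Convergence of the series and estimates on its partial sums *)

Section PadicBinomialSeries.
Variables (p : nat) (x : rat).
Hypotheses (p_prime : prime p) (x_lt1 : padic_abs p x < 1).
Local Notation abs := (padic_abs p).
Local Notation of_rat := (padic_of_rat p).
Local Notation norm := (@padic_norm p).
Local Notation F b := (padic_binomial_series p b x).

Let S (b : rat) := series (fun n => gbinom b n * x ^+ n).

Lemma padic_abs_expr (y : rat) (n : nat) : abs (y ^+ n) = abs y ^+ n.
Proof.
by elim: n => [|n IHn]; rewrite ?expr0 ?padic_abs1// !exprS padic_absM IHn.
Qed.

Lemma padic_abs_expr_small (e : rat) : 0 < e ->
  exists N : nat, forall n, (N <= n)%N -> abs x ^+ n < e.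
Proof.
move=> e0; have x1 : `|abs x| < 1 by rewrite ger0_norm ?padic_abs_ge0.
have [N _ xN] := cvgr0_norm_lt (fun n => abs x ^+ n : rat^o) (cvg_expr x1) e e0.
exists N => n Nn; have /= := xN n Nn.
by rewrite ger0_norm// exprn_ge0// padic_abs_ge0.
Qed.

Lemma binomial_term_le (b : rat) (N n : nat) : abs b <= 1 -> (N <= n)%N ->
  abs (gbinom b n * x ^+ n) <= abs x ^+ N.
Proof.
move=> b1 Nn; rewrite padic_absM padic_abs_expr.
apply: le_trans (_ : abs x ^+ n <= _).
  by rewrite ler_piMl ?exprn_ge0 ?padic_abs_ge0// padic_abs_gbinom_le1.
by rewrite ler_wiXn2l ?padic_abs_ge0// ltW.
Qed.

Lemma binomial_tail_le (b : rat) (N n : nat) : abs b <= 1 -> (N <= n)%N ->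
  abs (S b n - S b N) <= abs x ^+ N.
Proof.
move=> b1 Nn; rewrite sub_series_geq// big_seq_cond.
apply: padic_abs_sum_le => [|i]; first by rewrite exprn_ge0 ?padic_abs_ge0.
by rewrite mem_index_iota andbT => /andP[Ni _]; exact: binomial_term_le.
Qed.

Lemma binomial_partial_sums_cauchy (b : rat) : abs b <= 1 ->
  S b \in padic_cauchy p.
Proof.
move=> b1; apply/asboolP => e e0; have [N xN] := padic_abs_expr_small e e0.
exists N => m n Nm Nn; wlog mn : m n Nm Nn / (n <= m)%N => [h|].
  by have /orP[/h|/h] := leq_total n m; [|rewrite padic_abs_distC]; exact.
by apply: le_lt_trans (binomial_tail_le _ _ _ b1 mn) _; exact: xN.
Qed.

(** The rational partial sums converge to the class they define in ['Q_[p]], and the space being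
    Hausdorff, [limn] returns that class. *)
Lemma padic_binomial_series_cvg (b : rat) : abs b <= 1 ->
  (fun n => of_rat (S b n)) @ \oo --> F b.
Proof.
move=> b1; have Sb := binomial_partial_sums_cauchy b b1.
have cS := padic_cvg (erefl (\pi_('Q_[p])%qT (PadicCauchy Sb))).
rewrite /padic_binomial_series.
have -> : series (fun n => of_rat (gbinom b n * x ^+ n)) = fun n => of_rat (S b n).
  by apply/funext => n; rewrite /S !seriesEnat/= rmorph_sum.
by rewrite (cvg_lim (@metric_hausdorff rat 'Q_[p]) cS).
Qed.

(** The bound of [binomial_tail_le] survives the limit: otherwise a partial sum of index at least
    [N], closer to the limit than the supposed gap, contradicts the ultrametric inequality. *)
Lemma padic_binomial_series_tail (b : rat) (N : nat) : abs b <= 1 ->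
  norm (F b - of_rat (S b N)) <= abs x ^+ N.
Proof.
move=> b1; rewrite leNgt; apply/negP => xN.
have d0 := le_lt_trans (exprn_ge0 N (padic_abs_ge0 p x)) xN.
have /cvg_ballP/(_ _ d0)[K _ /(_ (maxn K N) (leq_maxl _ _))] :=
  padic_binomial_series_cvg b b1.
rewrite /= padic_ballE => dK.
set n := maxn K N in dK; have Nn : (N <= n)%N by rewrite leq_maxr.
have : norm ((F b - of_rat (S b n)) + of_rat (S b n - S b N))
    < norm (F b - of_rat (S b N)).
  apply: le_lt_trans (padic_normD_max _ _) _; rewrite gt_max dK padic_norm_rat.
  by apply: le_lt_trans xN; exact: binomial_tail_le.
by rewrite rmorphB/= addrA subrK ltxx.
Qed.

(** Reduces identities between sums of series to estimates on partial sums, since the powers of the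
    absolute value of [x] tend to 0. *)
Lemma padic_binomial_series_eq (b : rat) (y : 'Q_[p]) : abs b <= 1 ->
  (forall n, norm (y - of_rat (S b n)) <= abs x ^+ n) -> F b = y.
Proof.
move=> b1 yS; apply/eqP; rewrite -subr_eq0 -padic_norm_eq0 eq_le padic_norm_ge0 andbT.
rewrite leNgt; apply/negP => /padic_abs_expr_small[N /(_ N (leqnn N))].
apply/negP; rewrite -leNgt -[_ - y](subrKA (of_rat (S b N))).
apply: le_trans (padic_normD_max _ _) _.
by rewrite ge_max padic_binomial_series_tail// -padic_normN opprB yS.
Qed.

(* In [S a n * S b n] the terms of degree < n add up to [S (a + b) n] by
   Vandermonde, and all other terms are at most |x|^n. *)
Lemma binomial_partial_sumsM (a b : rat) (n : nat) : abs a <= 1 -> abs b <= 1 ->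
  abs (S a n * S b n - S (a + b) n) <= abs x ^+ n.
Proof.
move=> a1 b1; rewrite /S !seriesEord/=.
pose f i j := (gbinom a i * x ^+ i) * (gbinom b j * x ^+ j).
have -> : \sum_(k < n) gbinom (a + b) k * x ^+ k =
    \sum_(i < n) \sum_(j < n | (i + j < n)%N) f i j.
  (* Pairs are grouped by total degree [k], where Vandermonde applies, before the order of summation
     is exchanged. *)
  transitivity (\sum_(k < n) \sum_(i < n | (i <= k)%N) f i (k - i)%N).
    apply: eq_bigr => k _; rewrite -gbinom_Vandermonde mulr_suml.
    rewrite (big_ord_widen_cond n xpredT (fun i =>
      gbinom a i * gbinom b (k - i) * x ^+ k))//.
    by apply: eq_bigr => i ik; rewrite /f [RHS]mulrACA -exprD subnKC.
  rewrite (exchange_big_dep xpredT)//=; apply: eq_bigr => i _.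
  have := @big_nat_widenl rat 0 +%R i 0 n xpredT (fun k => f i (k - i)%N) (leq0n i).
  rewrite big_mkord => <-.
  rewrite -[X in \sum_(X <= _ < _) _]add0n big_addn.
  under eq_bigr do rewrite addnK.
  have := @big_nat_widen rat 0 +%R 0 (n - i) n xpredT (f i) (leq_subr i n).
  rewrite [X in _ = X -> _]big_mkord => ->.
  by apply: eq_bigl => j; rewrite /= ltn_subRL.
rewrite big_distrlr/= -sumrB.
apply: padic_abs_sum_le => [|i _]; first by rewrite exprn_ge0 ?padic_abs_ge0.
rewrite (bigID (fun j : 'I_n => (i + j < n)%N))/= addrAC subrr add0r.
apply: padic_abs_sum_le => [|j]; first by rewrite exprn_ge0 ?padic_abs_ge0.
rewrite -leqNgt => nij.
have -> : gbinom a i * x ^+ i * (gbinom b j * x ^+ j) =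
    (gbinom a i * gbinom b j) * x ^+ (i + j) by rewrite exprD mulrACA.
rewrite padic_absM padic_abs_expr.
apply: le_trans (_ : abs x ^+ (i + j) <= _).
  rewrite ler_piMl ?exprn_ge0 ?padic_abs_ge0//.
  by rewrite padic_absM_le1 ?padic_abs_gbinom_le1.
by rewrite ler_wiXn2l ?padic_abs_ge0// ltW.
Qed.

(** * The exponent law and integer exponents *)

Lemma padic_norm_binomial_sub1 (b : rat) : abs b <= 1 -> norm (F b - 1) < 1.
Proof.
move=> b1; apply: le_lt_trans x_lt1.
have := padic_binomial_series_tail b 1 b1.
by rewrite /S seriesEord/= big_ord1 gbinom0r mul1r expr0 rmorph1 expr1.
Qed.

Lemma padic_norm_binomial_le1 (b : rat) : abs b <= 1 -> norm (F b) <= 1.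
Proof.
move=> b1; rewrite -[F b](subrK 1); apply: le_trans (padic_normD_max _ _) _.
rewrite ge_max ltW ?padic_norm_binomial_sub1//=.
by rewrite -(rmorph1 of_rat) padic_norm_rat padic_abs1.
Qed.

Lemma padic_binomial_seriesD (a b : rat) : abs a <= 1 -> abs b <= 1 ->
  F (a + b) = F a * F b.
Proof.
move=> a1 b1; apply: padic_binomial_series_eq; first exact: padic_absD_le.
move=> n.
(* Two tails, each times a factor of norm at most 1, plus the error of multiplying partial sums;
   each term is within the bound. *)
have -> : F a * F b - of_rat (S (a + b) n) =
    (F a - of_rat (S a n)) * F b + of_rat (S a n) * (F b - of_rat (S b n))
    + of_rat (S a n * S b n - S (a + b) n).
  rewrite rmorphB rmorphM/=; ring.
have Sa1 : norm (of_rat (S a n)) <= 1.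
  rewrite padic_norm_rat /S seriesEord; apply: padic_abs_sum_le => // i _.
  exact: (binomial_term_le a 0).
have le_max3 (u v w : 'Q_[p]) M : norm u <= M -> norm v <= M -> norm w <= M ->
    norm (u + v + w) <= M.
  move=> uM vM wM; apply: le_trans (padic_normD_max _ _) _; rewrite ge_max wM andbT.
  by apply: le_trans (padic_normD_max _ _) _; rewrite ge_max uM.
apply: le_max3.
- rewrite padic_normM -[leRHS]mulr1 ler_pM ?padic_norm_ge0//.
    exact: padic_binomial_series_tail.
  exact: padic_norm_binomial_le1.
- rewrite padic_normM -[leRHS]mul1r ler_pM ?padic_norm_ge0//.
  exact: padic_binomial_series_tail.
- by rewrite padic_norm_rat; exact: binomial_partial_sumsM.
Qed.

Lemma padic_binomial_series0 : F 0 = 1.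
Proof.
apply: padic_binomial_series_eq => [|n]; first by rewrite padic_abs0.
rewrite -(rmorph1 of_rat) -rmorphB padic_norm_rat /S seriesEord/=.
case: n => [|n]; first by rewrite big_ord0 subr0 padic_abs1.
rewrite big_ord_recl/= gbinom0r mul1r big1.
  by rewrite addr0 subrr padic_abs0 exprn_ge0 ?padic_abs_ge0.
by move=> i _; rewrite (gbinom_nat 0) bin0n/= mul0r.
Qed.

Lemma padic_binomial_series1 : F 1 = of_rat (1 + x).
Proof.
apply: padic_binomial_series_eq => [|n]; first by rewrite padic_abs1.
rewrite -rmorphB padic_norm_rat /S seriesEord/=.
(* The partial sums are 0, then 1, then constantly [1 + x], so the errors are [1 + x], [x] and 0. *)
case: n => [|[|n]].
- rewrite big_ord0 subr0 padic_absD_le ?padic_abs1//; exact: ltW.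
- by rewrite big_ord1 gbinom0r expr0 mulr1 addrAC subrr add0r expr1.
rewrite !big_ord_recl/= gbinom0r mul1r (gbinom_nat 1) mul1r.
rewrite big1 ?addr0 ?subrr ?padic_abs0 ?exprn_ge0 ?padic_abs_ge0//.
by move=> i _; rewrite (gbinom_nat 1) bin_small// mul0r.
Qed.

Lemma padic_binomial_seriesMn (b : rat) (n : nat) : abs b <= 1 ->
  F (b *+ n) = F b ^+ n.
Proof.
move=> b1; elim: n => [|n IHn]; first by rewrite mulr0n padic_binomial_series0.
rewrite mulrS exprS padic_binomial_seriesD// ?IHn// -mulr_natr.
by rewrite padic_absM_le1 ?padic_abs_nat_le1.
Qed.

Lemma padic_binomial_series_int (r : int) : F r%:~R = of_rat ((1 + x) ^ r).
Proof.
case: r => n.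
  by rewrite -[(Posz n)%:~R]/(1 *+ n) padic_binomial_seriesMn ?padic_abs1//
    padic_binomial_series1 rmorphXn.
have n1 : abs n.+1%:R <= 1 by exact: padic_abs_nat_le1.
have Fn : F n.+1%:R = of_rat ((1 + x) ^+ n.+1).
  by rewrite padic_binomial_seriesMn ?padic_abs1// padic_binomial_series1 rmorphXn.
(* For a negative exponent, the exponent law and [F 0 = 1] make [F (- n.+1%:R)] the inverse of
   [F n.+1%:R], which is therefore nonzero. *)
have := padic_binomial_seriesD (- n.+1%:R) n.+1%:R.
rewrite padic_absN addNr padic_binomial_series0 => /(_ n1 n1) e.
rewrite NegzE mulrNz -[(Posz n.+1)%:~R]/(n.+1%:R).
have F0 : F n.+1%:R != 0.
  by apply/eqP => F0; move/eqP: e; rewrite F0 mulr0 oner_eq0.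
apply: (mulIf F0); rewrite -e Fn -rmorphM mulVf ?rmorph1//.
by apply: contra F0; rewrite Fn => /eqP->; rewrite rmorph0.
Qed.

End PadicBinomialSeries.

(** Since [b] times its denominator is its numerator, the exponent law leads to an integer exponent.
    The rational number on the right does not depend on [p], which is what links two primes. *)
Lemma padic_binomial_series_expr_denq (p : nat) (b x : rat) : prime p ->
  padic_abs p x < 1 -> padic_abs p b <= 1 ->
  padic_binomial_series p b x ^+ `|denq b| = padic_of_rat p ((1 + x) ^ numq b).
Proof.
move=> pp x1 b1; rewrite -padic_binomial_seriesMn// -padic_binomial_series_int//.
by rewrite numqE -mulr_natr -[RHS]/(_ _) -[(denq b)]gez0_abs ?denq_ge0.
Qed.

(** * Elements congruent to 1 and uniqueness of their roots *)

Lemma padic_normB_lt (p : nat) (y z : 'Q_[p]) (M : rat) :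
  padic_norm y < M -> padic_norm z < M -> padic_norm (y - z) < M.
Proof.
move=> yM zM; apply: le_lt_trans (padic_normD_max _ _) _.
by rewrite gt_max yM padic_normN.
Qed.

Lemma padic_unit1M (p : nat) (y z : 'Q_[p]) :
  padic_norm (y - 1) < 1 -> padic_norm (z - 1) < 1 -> padic_norm (y * z - 1) < 1.
Proof.
move=> y1 z1.
(* This is [(y - 1) * (z - 1) + (y - 1) + (z - 1)], written with differences to fit
   [padic_normB_lt]. *)
have -> : y * z - 1 = (y - 1) * (z - 1) - (1 - y - (z - 1)) by ring.
have y1' : padic_norm (1 - y) < 1 by rewrite -padic_normN opprB.
apply: padic_normB_lt; last exact: padic_normB_lt.
by rewrite padic_normM mulr_ilt1 ?padic_norm_ge0.
Qed.

Lemma padic_unit1X (p : nat) (y : 'Q_[p]) (n : nat) :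
  padic_norm (y - 1) < 1 -> padic_norm (y ^+ n - 1) < 1.
Proof.
move=> y1; elim: n => [|n IHn]; first by rewrite expr0 subrr padic_norm0.
by rewrite exprS padic_unit1M.
Qed.

(* [y ^+ n - z ^+ n] is [y - z] times a sum congruent to [n], a unit. *)
Lemma padic_eq_of_expr_eq (p n : nat) (y z : 'Q_[p]) : prime p -> coprime p n ->
  padic_norm (y - 1) < 1 -> padic_norm (z - 1) < 1 -> y ^+ n = z ^+ n -> y = z.
Proof.
move=> pp pn y1 z1 /eqP; rewrite -subr_eq0 subrXX mulf_eq0 subr_eq0.
case/orP => [/eqP//|/eqP s0].
have : padic_norm (\sum_(i < n) (y ^+ (n.-1 - i) * z ^+ i - 1)) < 1.
  apply: (big_ind (fun t : 'Q_[p] => padic_norm t < 1)) => [|t u t1 u1|i _].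
  - by rewrite padic_norm0.
  - by rewrite -[u]opprK padic_normB_lt ?padic_normN.
  - by rewrite padic_unit1M ?padic_unit1X.
(* If the cofactor vanishes, this sum is [- n], whose norm is 1 because [n] is prime to [p]. *)
rewrite sumrB s0 sub0r padic_normN sumr_const card_ord.
by rewrite -(rmorph_nat (padic_of_rat p)) padic_norm_rat padic_abs_coprime// ltxx.
Qed.

Theorem theorem4p7 (r s : int) (b x : rat) (v' : nat) (c : rat)
  (hs : s != 0) (hb : b = r%:~R / s%:~R)
  (pv' : prime v') (xv' : padic_abs v' x < 1) (bv' : padic_abs v' b <= 1)
  (hc : padic_binomial_series v' b x = padic_of_rat v' c) :
  forall v : nat, prime v -> padic_abs v x < 1 -> padic_abs v b <= 1 ->
    padic_abs v (c - 1) < 1 \/ padic_abs v (- c - 1) < 1 ->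
    exists d : rat, padic_binomial_series v b x = padic_of_rat v d.
Proof.
move=> v pv xv bv cv.
(* The root is taken with the reduced denominator of [b], which is prime to [v], whereas [s] may
   share a factor [v] with [r]. *)
have n_coprime := padic_int_coprime v pv b bv.
(* The embedding of the rationals at [v'] is injective, so the identity known there descends to the
   rationals and can be used at [v]. *)
have cE : c ^+ `|denq b| = (1 + x) ^ numq b.
  apply: (fmorph_inj (padic_of_rat v')).
  by rewrite rmorphXn/= -hc padic_binomial_series_expr_denq.
have := padic_binomial_series_expr_denq v b x pv xv bv.
have := padic_norm_binomial_sub1 v x pv xv b bv.
rewrite -cE; move: (padic_binomial_series v b x) => y y1 yn.
set n := `|denq b|%N in n_coprime yn.
have norm_rat1 a : padic_norm (padic_of_rat v a - 1) = padic_abs v (a - 1).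
  by rewrite -(rmorph1 (padic_of_rat v)) -rmorphB padic_norm_rat.
(* Such a [d] has the same [n]-th power as [y], and both are congruent to 1, so they are equal. *)
suff [d d1 dn] : exists2 d, padic_abs v (d - 1) < 1 & d ^+ n = c ^+ n.
  exists d; apply: (padic_eq_of_expr_eq v n) => //; first by rewrite norm_rat1.
  by rewrite yn -rmorphXn dn.
case: cv => [c1|Nc1]; first by exists c.
(* For even [n], the sign disappears in the [n]-th power and [- c] itself is the value. *)
have [n_odd|n_even] := boolP (odd n); last first.
  by exists (- c) => //; rewrite exprNn -signr_odd (negPf n_even) expr0 mul1r.
(* For [n] odd, [y ^+ n] and [(- c) ^+ n] are opposite, yet both are congruent
   to 1, so |2|_v < 1 and [c] itself is congruent to 1 (in fact v = 2). *)
exists c => //.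
have yn1 := padic_unit1X v y n y1.
have Nc1' : padic_norm (padic_of_rat v (- c) ^+ n - 1) < 1.
  by apply: padic_unit1X; rewrite norm_rat1.
have abs2 : padic_norm (- (1 + 1) : 'Q_[v]) < 1.
  have -> : - (1 + 1) = y ^+ n - 1 - (1 - padic_of_rat v (- c) ^+ n).
    rewrite yn -rmorphXn exprNn -signr_odd n_odd expr1 mulN1r rmorphN; ring.
  by apply: padic_normB_lt => //; rewrite -padic_normN opprB.
rewrite -norm_rat1.
have -> : padic_of_rat v c - 1 = - (1 + 1) - (padic_of_rat v (- c) - 1).
  by rewrite rmorphN; ring.
by apply: padic_normB_lt; rewrite ?norm_rat1.
Qed.
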